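(* If $p=p(n)=o(n^{-7/8})$ then for $G=G(n,p)$, whp, $\tau(G)=n-\max\gamma(H)$, where the maximum is taken over all induced subgraphs $H$ of $G$ in which any connected component is either an isolated vertex or a cycle of length $4$.
   Context: $G(n,p)$ is the random graph on $n$ labeled vertices in which each pair of vertices is an edge independently with probability $p$. ''Whp'' means with probability tending to $1$ as $n$ tends to infinity. For a graph $G$, $\tau(G)$ is the minimum number of pairwise edge disjoint complete bipartite subgraphs of $G$ (not necessarily induced) such that each edge of $G$ belongs to exactly one of them. For a graph $H$ in which every connected component is either an isolated vertex or a cycle of length $4$, $\gamma(H)$ denotes the number of vertices of $H$ minus the number of cycles of length $4$ in it. *)

(* Defs.v *)
From mathcomp Require Import all_boot all_order all_algebra.

Set Implicit Arguments.
Unset Strict Implicit.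
Unset Printing Implicit Defensive.

Import Order.TTheory GRing.Theory Num.Theory.

(* A simple graph on the finite vertex set V is given by its set of edges
   E : {set {set V}} with E \subset pairs V. *)

Section Graphs.
Variable V : finType.
Implicit Types (S C A B : {set V}) (E Q : {set {set V}})
  (F : {set {set {set V}}}).

Definition pairs : {set {set V}} := [set e : {set V} | #|e| == 2].

Definition complete_bipartite A B : {set {set V}} :=
  [set [set a; b] | a in A, b in B].

Definition is_biclique Q : bool :=
  [exists A : {set V}, exists B : {set V},
     [disjoint A & B] && (Q == complete_bipartite A B)].

(* A complete bipartite subgraph is identified with its set of edges;
   [partition] moreover discards subgraphs without edges, which never help
   to minimize the number of subgraphs. *)
Definition biclique_partition E F : bool :=
  partition F E && [forall Q in F, is_biclique Q].

Definition single_edges E : {set {set {set V}}} := [set [set e] | e in E].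

Lemma biclique_partition_single_edges E :
  E \subset pairs -> biclique_partition E (single_edges E).
Proof.
move=> /subsetP sE; apply/andP; split; last first.
  apply/forall_inP => Q /imsetP[e eE ->{Q}].
  have := sE _ eE; rewrite inE => /cards2P[a [b [ab ->]]].
  apply/existsP; exists [set a]; apply/existsP; exists [set b].
  rewrite disjoints1 inE ab /=; apply/eqP/setP => x; rewrite inE.
  apply/eqP/imset2P => [->|[a' b' /set1P -> /set1P -> ->]] //.
  by exists a b; rewrite ?set11.
apply/and3P; split.
- rewrite /cover; apply/eqP/setP => e; apply/bigcupP/idP.
    by move=> [_ /imsetP[f fE ->]] /set1P ->.
  by move=> eE; exists [set e]; rewrite ?set11 ?imset_f.
- apply/trivIsetP => _ _ /imsetP[e _ ->] /imsetP[f _ ->] ef.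
  by rewrite disjoints1 inE; apply: contra ef => /eqP ->.
- by apply/imsetP => -[e _ /setP/(_ e)]; rewrite !inE eqxx.
Qed.

Definition tau E : nat :=
  #|[arg min_(F < single_edges E | biclique_partition E F) #|F|]|.

Definition induced E S : {set {set V}} := [set e in E | e \subset S].

Definition components E S : {set {set V}} :=
  equivalence_partition
    (connect [rel x y | [set x; y] \in induced E S]) S.

Definition is_cycle4 S E : bool :=
  [exists a, exists b, exists c, exists d,
     [&& uniq [:: a; b; c; d], S == [set a; b; c; d] &
         E == [set [set a; b]; [set b; c]; [set c; d]; [set d; a]]]].

Definition isolated_or_cycle4 E S : bool :=
  [forall C in components E S, (#|C| == 1) || is_cycle4 C (induced E C)].

Definition cycles4 E : {set {set {set V}}} :=
  [set Q in powerset E | is_cycle4 (cover Q) Q].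

Definition gamma E S : nat := #|S| - #|cycles4 (induced E S)|.

End Graphs.

Arguments pairs V : clear implicits.

Local Open Scope ring_scope.

Definition gnp_weight (R : realFieldType) (V : finType) (p : R)
    (E : {set {set V}}) : R :=
  \prod_(e in pairs V) (if e \in E then p else 1 - p).

(* The probability that G(n,p), with #|V| = n, has the property P. *)
Definition gnp_prob (R : realFieldType) (V : finType) (p : R)
    (P : pred {set {set V}}) : R :=
  \sum_(E in powerset (pairs V) | P E) gnp_weight p E.

Lemma gnp_prob_edges (R : realFieldType) (V : finType) (p : R) (Q : {set {set V}}) :
  Q \subset pairs V -> gnp_prob p (fun E => Q \subset E) = p ^+ #|Q|.
Proof.
move=> sQ.
pose f e := if e \in pairs V then p else 0.
pose g e : R := if e \in Q then 0 else if e \in pairs V then 1 - p else 1.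
have := @bigA_distr R 0 1 *%R +%R _ f g.
rewrite (bigID [in Q]) /= [X in _ * X]big1 ?mulr1; last first.
  by move=> e eQ; rewrite /f /g (negbTE eQ); case: ifP => _;
    rewrite ?add0r // addrC subrK.
rewrite (eq_bigr (fun=> p)); last first.
  by move=> e eQ; rewrite /f /g eQ (subsetP sQ) // addr0.
rewrite prodr_const => ->.
rewrite /gnp_prob /gnp_weight big_mkcond /=; apply: eq_bigr => J _.
rewrite powersetE; case: ifPn => [/andP[sJ sQJ]|].
  rewrite [RHS](bigID [in pairs V]) /= [X in _ = _ * X]big1 ?mulr1.
    apply: eq_bigr => e eP; rewrite /f /g eP; case: ifPn => // eJ.
    by rewrite (negbTE (contra (subsetP sQJ e) eJ)).
  move=> e eP; rewrite /f /g (negbTE eP).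
  rewrite (negbTE (contra (subsetP sJ e) eP)).
  by rewrite (negbTE (contra (subsetP sQ e) eP)).
rewrite negb_and => /orP[] /subsetPn[e e1 e2]; rewrite (bigD1 e) //=.
  by rewrite /f e1 (negbTE e2) mul0r.
by rewrite /g (negbTE e2) e1 mul0r.
Qed.

Lemma gnp_prob_total (R : realFieldType) (V : finType) (p : R) :
  gnp_prob p (fun _ : {set {set V}} => true) = 1.
Proof.
have := @gnp_prob_edges R V p set0; rewrite sub0set cards0 expr0 => <- //.
by apply: eq_bigl => E; rewrite sub0set.
Qed.

(* Main.v *)
From mathcomp Require Import all_boot all_order all_algebra.
From mathcomp Require Import all_classical all_reals all_analysis.
From mathcomp Require Import fintype finset.
From mathcomp Require Import zify ring lra.
Require Import Defs.

(** The formula for [tau] holds for every graph in which distinct 4-cycles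
    have disjoint vertex sets, and whp the random graph is of this kind.

    Upper bound, for every graph ([tau_le_gamma]): if all components of the
    graph induced on [S] are isolated vertices or 4-cycles, then the edges that
    leave [S] split into at most [n - #|S|] stars centred outside [S], and each
    4-cycle component is itself a K_{2,2}; this decomposition has at most
    [n - gamma E S] bicliques.

    Lower bound, when distinct 4-cycles are disjoint ([tau_ge_gamma]): such a
    graph contains no K_{2,3}, so every biclique of an optimal decomposition is
    a star or a 4-cycle.  Let T be the set of the centres of the stars.  As long
    as some remaining 4-cycle of the decomposition meets T in a vertex x, trade
    it for the vertex opposite to x: together with x it touches all four edges,
    so the edges outside the remaining cycles still all meet T, and the size of
    T plus the number of remaining cycles does not grow
    ([transversal_off_cycles]).  At the end the remaining cycles avoid T and
    contain all edges avoiding T; as they meet no other 4-cycle, they are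
    components of the graph induced on the complement S of T, the other
    components being isolated vertices ([isolated_or_cycle4_of_cycles]).  Hence
    [n - gamma E S] is at most the number of bicliques.

    Probability: let two distinct 4-cycles share a vertex, and let k <= 3 be the
    number of vertices of the second one outside the first.  Their union has at
    least 5 + k edges on 4 + k vertices ([card_meeting_cycles4]).  Summing
    p^(5+k) over all positions gives the union bound
    n^4 * 4 p^5 * (4 + n p)^3 for the probability that such a pair exists
    ([prob_meeting_cycles4_le]).  With p = x n^(-7/8), x -> 0, this is
    O(x^5) -> 0.  The exponent 7/8 comes from the case k = 3, two
    4-cycles with one common vertex, whose expected number is of order
    n^7 p^8. *)

Set Implicit Arguments.
Unset Strict Implicit.
Unset Printing Implicit Defensive.

Import Order.TTheory GRing.Theory Num.Theory.
Import numFieldNormedType.Exports.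

(** * Four-cycles and stars as bicliques *)

Section Graphs.
Variable V : finType.
Implicit Types (S C T A B : {set V}) (E Q : {set {set V}})
  (F : {set {set {set V}}}).

Definition cycle4 (a b c d : V) : {set {set V}} :=
  [set [set a; b]; [set b; c]; [set c; d]; [set d; a]].

Lemma is_cycle4P S E :
  reflect (exists a b c d, [/\ uniq [:: a; b; c; d], S = [set a; b; c; d] &
                               E = cycle4 a b c d])
          (is_cycle4 S E).
Proof.
apply: (iffP existsP) => [[a /existsP[b /existsP[c /existsP[d]]]]|].
  by case/and3P => u /eqP-> /eqP->; exists a, b, c, d.
case=> a [b [c [d [u -> ->]]]]; exists a; apply/existsP; exists b.
by apply/existsP; exists c; apply/existsP; exists d; rewrite u !eqxx.
Qed.

Lemma cover_cycle4 a b c d : cover (cycle4 a b c d) = [set a; b; c; d].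
Proof.
apply/setP => x; apply/bigcupP/idP => [[e]|].
  by rewrite !inE -!orbA => /or4P[] /eqP-> /set2P[]->; rewrite eqxx ?orbT.
by rewrite !inE -!orbA => /or4P[] /eqP->;
  [exists [set a; b] | exists [set a; b] | exists [set c; d] | exists [set c; d]];
  rewrite !inE ?eqxx ?orbT.
Qed.

Lemma cycles4P E Q :
  reflect (exists a b c d, [/\ uniq [:: a; b; c; d], Q = cycle4 a b c d & Q \subset E])
          (Q \in cycles4 E).
Proof.
rewrite inE powersetE; apply: (iffP andP) => [[QE /is_cycle4P]|].
  by case=> a [b [c [d [u _ eQ]]]]; exists a, b, c, d.
case=> a [b [c [d [u eQ QE]]]]; split=> //; apply/is_cycle4P.
by exists a, b, c, d; split=> //; rewrite eQ cover_cycle4.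
Qed.

Lemma cycle4_bipartite a b c d :
  cycle4 a b c d = complete_bipartite [set a; c] [set b; d].
Proof.
apply/setP => e; apply/idP/imset2P => [|[x y]].
  rewrite !inE -!orbA => /or4P[] /eqP->.
  - by exists a b; rewrite ?set21.
  - by exists c b; rewrite ?set21 ?set22 // setUC.
  - by exists c d; rewrite ?set22.
  - by exists a d; rewrite ?set21 ?set22 // setUC.
by move=> /set2P[] -> /set2P[] -> ->; rewrite !inE
  ?(setUC [set c] [set b]) ?(setUC [set a] [set d]) eqxx ?orbT.
Qed.

Lemma cycle4_rot a b c d : cycle4 b c d a = cycle4 a b c d.
Proof. by rewrite /cycle4 [LHS]setUC !setUA. Qed.

(** Two opposite vertices of a 4-cycle touch all its edges. *)
Lemma cycle4_opposite E Q x : Q \in cycles4 E -> x \in cover Q ->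
  exists y, forall e, e \in Q -> (x \in e) || (y \in e).
Proof.
case/cycles4P=> a [b [c [d [_ -> _]]]]; rewrite cover_cycle4 !inE -!orbA.
by case/or4P => /eqP->; [exists c | exists d | exists a | exists b] => e;
  rewrite !inE -!orbA => /or4P[] /eqP->; rewrite !inE eqxx ?orbT.
Qed.

Lemma cycle4_pairs a b c d :
  uniq [:: a; b; c; d] -> cycle4 a b c d \subset pairs V.
Proof.
rewrite /= !inE !negb_or -!andbA => /and5P[ab ac ad bc /and3P[bd cd _]].
apply/subsetP => e; rewrite !inE -!orbA.
by case/or4P => /eqP ->; rewrite cards2 ?ab ?bc ?cd // (eq_sym d) ad.
Qed.

Lemma edge2 E e : E \subset pairs V -> e \in E -> exists x y, e = [set x; y].
Proof.
by move=> /subsetP sE /sE; rewrite inE => /cards2P[x [y [_ ->]]]; exists x, y.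
Qed.

Lemma edge_incident E e : E \subset pairs V -> e \in E -> exists x, x \in e.
Proof. by move=> sE /(edge2 sE)[x [y ->]]; exists x; rewrite set21. Qed.

(** * Decompositions from vertex sets *)

Lemma tau_le E F : E \subset pairs V -> biclique_partition E F -> tau E <= #|F|.
Proof.
move=> sE pF; rewrite /tau; case: arg_minnP => [|F' _]; last exact.
exact: biclique_partition_single_edges.
Qed.

Lemma tau_attained E : E \subset pairs V ->
  exists2 F, biclique_partition E F & tau E = #|F|.
Proof.
move=> sE; rewrite /tau; case: arg_minnP => [|F pF _]; last by exists F.
exact: biclique_partition_single_edges.
Qed.

(** A labelling of the edges by a finite type is the convenient way to give a
    partition: disjointness, covering and nonemptiness of the classes are
    automatic. *)
Lemma tau_le_labels E (L : finType) (f : {set V} -> L) : E \subset pairs V ->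
  (forall e, e \in E -> is_biclique [set e' in E | f e' == f e]) ->
  tau E <= #|f @: E|.
Proof.
move=> sE bicl; pose fibre l := [set e' in E | f e' == l].
have defP : preim_partition f E = fibre @: (f @: E).
  rewrite -imset_comp; apply: eq_in_imset => e _.
  by apply/setP => e'; rewrite !inE /= eq_sym.
apply: (@leq_trans #|preim_partition f E|); last first.
  by rewrite defP leq_imset_card.
apply: tau_le => //; apply/andP; split; first exact: preim_partitionP.
apply/forall_inP => Q; rewrite defP => /imsetP[_ /imsetP[e eE ->] ->].
exact: bicl.
Qed.

Lemma star_biclique E v : E \subset pairs V -> (forall e, e \in E -> v \in e) ->
  is_biclique E.
Proof.
move=> sE vE; apply/existsP; exists [set v].
apply/existsP; exists [set w | [set v; w] \in E].
rewrite disjoints1 inE; apply/andP; split.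
  by apply/negP=> /(subsetP sE); rewrite inE setUid cards1.
apply/eqP/setP => e; apply/idP/imset2P => [eE|[_ w /set1P-> + ->]]; last first.
  by rewrite inE.
have [x [y exy]] := edge2 sE eE; have := vE _ eE; rewrite exy => /set2P[] ev.
  by exists v y; rewrite ?set11 ?inE //; rewrite ev -?exy.
by exists v x; rewrite ?set11 ?inE //; rewrite ev setUC -?exy.
Qed.

(** The relation whose classes on [S] are the [components E S]. *)
Definition linked E S : rel V := connect [rel x y | [set x; y] \in induced E S].

Lemma linked_equiv E S : {in S & &, equivalence_rel (linked E S)}.
Proof.
move=> x y z _ _ _; split; first exact: connect0.
by move=> xy; apply: same_connect xy z; apply: sym_connect_sym => u v /=; rewrite setUC.
Qed.

Lemma components_partition E S : partition (components E S) S.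
Proof. exact/equivalence_partitionP/linked_equiv. Qed.

Lemma component_sub E S C : C \in components E S -> C \subset S.
Proof. by case/imsetP => x _ ->; rewrite setIdE subsetIl. Qed.

Lemma component_of_edge E S x y : [set x; y] \in induced E S ->
  exists2 C, C \in components E S & [set x; y] \subset C.
Proof.
move=> xyE; have := xyE; rewrite inE => /andP[_]; rewrite subUset !sub1set => /andP[xS yS].
exists [set z in S | linked E S x z]; first exact: imset_f.
rewrite subUset !sub1set !inE xS yS /linked connect0 /=.
by apply: connect1 => /=.
Qed.

(** The edges that leave [S] are grouped into stars centred outside [S]; those
    inside [S] are grouped by component. *)
Lemma tau_le_components E S : E \subset pairs V -> isolated_or_cycle4 E S ->
  tau E <= #|~: S| + #|[set C in components E S | is_cycle4 C (induced E C)]|.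
Proof.
move=> sE /forall_inP isoS; set D := [set C in _ | _].
have [_ tiC _] := and3P (components_partition E S).
(* The default value [set0] is never used: an edge inside [S] lies in a
   component. *)
pose f (e : {set V}) : V + {set V} :=
  if [pick x in e :\: S] is Some x then inl x
  else inr (odflt set0 [pick C in components E S | e \subset C]).
have f_out e x : f e = inl x -> x \in e :\: S.
  by rewrite /f; case: pickP => [y ye [<-]|].
have f_in e C : e \in E -> f e = inr C ->
    [/\ C \in components E S, e \subset C & e \subset S].
  move=> eE; rewrite /f; case: pickP => // eS; have {}eS : e \subset S.
    by rewrite -setD_eq0; apply/eqP/setP => x; rewrite in_set0; exact: eS.
  have [x [y exy]] := edge2 sE eE.
  have [|C' C'c eC'] := @component_of_edge E S x y; first by rewrite -exy inE eE.
  case: pickP => [C'' /andP[C''c eC''] [<-]//|/(_ C')].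
  by rewrite C'c exy eC'.
have f_cycle e C : e \in E -> f e = inr C -> is_cycle4 C (induced E C).
  move=> eE /f_in-/(_ eE)[Cc eC _]; have /orP[|//] := isoS _ Cc.
  have := subsetP sE _ eE; rewrite inE => /eqP e2 /eqP C1.
  by have := subset_leq_card eC; rewrite C1 e2.
apply: (@leq_trans #|f @: E|).
  apply: tau_le_labels => // e eE; set Q := [set _ in _ | _].
  have sQ : Q \subset E by rewrite /Q setIdE subsetIl.
  case fe: (f e) => [x|C].
    apply: (@star_biclique _ x) => [|e']; first exact: subset_trans sE.
    by rewrite inE fe => /andP[_ /eqP /f_out]; rewrite inE => /andP[].
  have [Cc eC eS] := f_in _ _ eE fe.
  have -> : Q = induced E C.
    apply/setP => e'; rewrite !inE fe.
    case e'E: (e' \in E) => //=; apply/eqP/idP => [/f_in-/(_ e'E)[]//|e'C].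
    case fe': (f e') => [x|C'].
      have := f_out _ _ fe'; rewrite inE => /andP[/negP xS /(subsetP e'C) xC].
      by case: xS; exact: subsetP (component_sub Cc) x xC.
    have [C'c e'C' _] := f_in _ _ e'E fe'.
    have [x xe'] := edge_incident sE e'E.
    congr inr; rewrite -(def_pblock tiC Cc (subsetP e'C _ xe')).
    by rewrite (def_pblock tiC C'c (subsetP e'C' _ xe')).
  have /is_cycle4P[a [b [c [d [u _ ->]]]]] := f_cycle _ _ eE fe.
  rewrite cycle4_bipartite; apply/existsP; exists [set a; c]; apply/existsP.
  exists [set b; d]; rewrite eqxx andbT.
  move: u; rewrite /= !inE !negb_or -!andbA => /and5P[ab ac ad bc /and3P[bd cd _]].
  rewrite disjoints_subset subUset !sub1set !inE !negb_or.
  by rewrite (eq_sym c b) ab ad bc cd.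
have -> : #|~: S| = #|(@inl V {set V}) @: (~: S)| by rewrite card_imset // => x y [].
have -> : #|D| = #|(@inr V {set V}) @: D| by rewrite card_imset // => x y [].
apply: leq_trans (leq_card_setU _ _); apply: subset_leq_card.
apply/subsetP => _ /imsetP[e eE ->]; rewrite inE; case fe: (f e) => [x|C].
  by rewrite imset_f // inE; have := f_out _ _ fe; rewrite inE => /andP[].
apply/orP; right; rewrite imset_f // inE (f_cycle _ _ eE fe) andbT.
by have [] := f_in _ _ eE fe.
Qed.

Lemma card_cycle_components E S :
  #|[set C in components E S | is_cycle4 C (induced E C)]|
    <= #|cycles4 (induced E S)|.
Proof.
set D := [set _ in _ | _].
have inD C : C \in D -> cover (induced E C) = C.
  rewrite inE => /andP[_ /is_cycle4P[a [b [c [d [_ -> ->]]]]]].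
  exact: cover_cycle4.
rewrite -(@card_in_imset _ _ (induced E) D) => [|C C' /inD + /inD]; last first.
  by move=> eC eC' eCC'; rewrite -eC eCC'.
apply/subset_leq_card/subsetP => _ /imsetP[C CD ->].
rewrite inE (inD _ CD); move: CD; rewrite inE powersetE => /andP[Cc ->].
rewrite andbT; apply/subsetP => e; rewrite !inE => /andP[-> eC] /=.
exact: subset_trans eC (component_sub Cc).
Qed.

(** When the subtraction in [gamma] truncates, the bound reads [tau E <= #|V|],
    which follows from there being at most [#|S|] components. *)
Lemma tau_le_gamma E S : E \subset pairs V -> isolated_or_cycle4 E S ->
  tau E <= #|V| - gamma E S.
Proof.
move=> sE isoS; have tauS := tau_le_components sE isoS.
have c_le := card_cycle_components E S; set D := [set _ in _ | _] in tauS c_le.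
have D_le : #|D| <= #|S|.
  have pC := components_partition E S; rewrite (card_partition pC).
  rewrite (@leq_trans #|components E S|) //.
    by apply/subset_leq_card/subsetP => C; rewrite inE => /andP[].
  rewrite -sum1_card leq_sum // => C Cc.
  by rewrite card_gt0; apply: contraTneq Cc => ->; have [_ _] := and3P pC.
have := cardsC S; rewrite /gamma; move: tauS c_le D_le; lia.
Qed.

(** * Vertex sets from decompositions *)

Lemma block_sub_cover (W : finType) (P : {set {set W}}) (B : {set W}) : B \in P -> B \subset cover P.
Proof. by move=> BP; apply: bigcup_max BP _. Qed.

Definition disjoint_cycles4 E : bool :=
  [forall Q in cycles4 E, forall Q' in cycles4 E,
     (Q != Q') ==> [disjoint cover Q & cover Q']].

Lemma disjoint_cycles4P E x Q Q' : disjoint_cycles4 E ->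
  Q \in cycles4 E -> Q' \in cycles4 E -> x \in cover Q -> x \in cover Q' -> Q = Q'.
Proof.
move=> /forall_inP dE Qc Q'c xQ xQ'; have /forall_inP/(_ _ Q'c) := dE _ Qc.
by case: eqP => //= _ /disjointFr/(_ xQ); rewrite xQ'.
Qed.

Lemma complete_bipartiteC A B : complete_bipartite A B = complete_bipartite B A.
Proof.
by apply/setP => e; apply/imset2P/imset2P => -[x y xA yB ->];
  exists y x; rewrite // setUC.
Qed.

Lemma cycle4_in_bipartite E A B a a' b b' :
  [disjoint A & B] -> complete_bipartite A B \subset E ->
  a \in A -> a' \in A -> a != a' -> b \in B -> b' \in B -> b != b' ->
  cycle4 a b a' b' \in cycles4 E.
Proof.
move=> dAB sE aA a'A aa' bB b'B bb'; apply/cycles4P; exists a, b, a', b'.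
have dif x y : x \in A -> y \in B -> x != y.
  by move=> xA yB; apply: contraTneq yB => <-; rewrite (disjointFr dAB xA).
split=> //=.
  by rewrite !inE !negb_or aa' bb' (eq_sym b a') !dif.
apply: subset_trans sE; rewrite cycle4_bipartite; apply/subsetP => e.
case/imset2P => x y xaa' ybb' ->; apply: imset2_f.
  by case/set2P: xaa' => ->.
by case/set2P: ybb' => ->.
Qed.

(** A third vertex on one side of a complete bipartite graph would give two
    4-cycles through a common vertex. *)
Lemma side_of_bipartite E A B a a' b b' x : disjoint_cycles4 E ->
  [disjoint A & B] -> complete_bipartite A B \subset E ->
  a \in A -> a' \in A -> a != a' -> b \in B -> b' \in B -> b != b' ->
  x \in A -> x \in [set a; a'].
Proof.
move=> dE dAB sE aA a'A aa' bB b'B bb' xA; rewrite !inE.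
case: (eqVneq x a) => //= xa; case: (eqVneq x a') => // xa'.
have c1 := cycle4_in_bipartite dAB sE aA a'A aa' bB b'B bb'.
have ax : a != x by rewrite eq_sym.
have c2 := cycle4_in_bipartite dAB sE aA xA ax bB b'B bb'.
have e12 : cycle4 a b a' b' = cycle4 a b x b'.
  by apply: (disjoint_cycles4P (x := a)) c1 c2 _ _; rewrite // cover_cycle4 !inE eqxx.
have := congr1 (fun Q => x \in cover Q) e12; rewrite !cover_cycle4 !inE eqxx orbT /=.
rewrite (negbTE xa) (negbTE xa') /= orbF => /orP[] /eqP xb.
  by rewrite xb (disjointFl dAB bB) in xA.
by rewrite xb (disjointFl dAB b'B) in xA.
Qed.

(** A biclique with two vertices on each side contains a 4-cycle, and by
    [side_of_bipartite] it contains nothing else. *)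
Lemma biclique_star_or_cycle4 E Q : disjoint_cycles4 E ->
  Q \subset E -> is_biclique Q -> Q != set0 ->
  Q \notin cycles4 E -> exists v, forall e, e \in Q -> v \in e.
Proof.
move=> dE QE /existsP[A /existsP[B /andP[dAB /eqP eQ]]] /set0Pn[e0].
rewrite {1}eQ => /imset2P[a0 b0 a0A b0B _].
have [A1|/card_gt1P[a [a' [aA a'A aa']]]] := leqP #|A| 1.
  exists a0 => e; rewrite eQ => /imset2P[a b aA _ ->].
  by have /card_le1_eqP/(_ _ _ a0A aA)<- := A1; rewrite set21.
have [B1|/card_gt1P[b [b' [bB b'B bb']]]] := leqP #|B| 1.
  exists b0 => e; rewrite eQ => /imset2P[a1 b _ bB ->].
  by have /card_le1_eqP/(_ _ _ b0B bB)<- := B1; rewrite set22.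
have sE : complete_bipartite A B \subset E by rewrite -eQ.
suff -> : Q = cycle4 a b a' b' by rewrite (cycle4_in_bipartite dAB).
have -> : Q = complete_bipartite [set a; a'] [set b; b'].
  rewrite eQ; congr complete_bipartite; apply/eqP; rewrite eqEsubset.
    rewrite subUset !sub1set aA a'A /= andbT; apply/subsetP => x.
    exact: (side_of_bipartite dE dAB sE aA a'A aa' bB b'B bb').
  rewrite subUset !sub1set bB b'B /= andbT; apply/subsetP => x.
  rewrite complete_bipartiteC disjoint_sym in dAB sE.
  exact: (side_of_bipartite dE dAB sE bB b'B bb' aA a'A aa').
by rewrite -cycle4_bipartite.
Qed.

(** If a cycle of [F] contains a vertex of [T], adding the opposite vertex to [T]
    makes [T] touch all its edges, so the cycle can be dropped from [F]; repeat
    until [T] avoids all the cycles kept. *)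
Lemma transversal_off_cycles E F T : F \subset cycles4 E ->
  (forall e, e \in E -> e \notin cover F -> exists2 x, x \in T & x \in e) ->
  exists F' T', [/\ F' \subset cycles4 E, #|T'| + #|F'| <= #|T| + #|F|,
    forall e, e \in E -> e \notin cover F' -> exists2 x, x \in T' & x \in e
    & forall Q, Q \in F' -> [disjoint cover Q & T']].
Proof.
have [m] := ubnP #|F|; elim: m => // m IH in F T *; rewrite ltnS => Fm Fc touch.
have [dF|] := boolP [forall Q in F, [disjoint cover Q & T]].
  by exists F, T; split=> //; exact/forall_inP.
rewrite negb_forall_in => /exists_inP[Q QF].
rewrite disjoint_subset => /subsetPn[x xQ]; rewrite inE negbK => xT.
have [y oppy] := cycle4_opposite (subsetP Fc _ QF) xQ.
have cF : #|F| = (#|F :\ Q|).+1 by rewrite (cardsD1 Q) QF.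
have [||e eE eF|F' [T' [F'c leF' touch' dF']]] := IH (F :\ Q) (y |: T).
- by rewrite -ltnS -cF.
- exact: subset_trans (subsetDl _ _) Fc.
- have [eQ|eQ] := boolP (e \in Q).
    have /orP[xe|ye] := oppy _ eQ; last by exists y; rewrite ?setU11.
    by exists x; rewrite // setU1r.
  have [|z zT ze] := touch e eE; last by exists z; rewrite // setU1r.
  apply: contra eF => /bigcupP[Q' Q'F eQ']; apply/bigcupP; exists Q' => //.
  by rewrite !inE Q'F andbT; apply: contraTneq eQ' => ->.
exists F', T'; split=> //; apply: leq_trans leF' _.
by rewrite cF addnS -addSn leq_add2r cardsU1; case: (y \notin T).
Qed.

(** An edge inside [S] that touches a cycle of [F] lies in some cycle of [F] and
    hence in this very one, because distinct 4-cycles are disjoint: no edge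
    leaves a cycle of [F], or is a chord of it.  The vertices of [S] off the
    cycles of [F] are isolated. *)
Lemma isolated_or_cycle4_of_cycles E F S : E \subset pairs V ->
  disjoint_cycles4 E -> F \subset cycles4 E ->
  (forall Q, Q \in F -> cover Q \subset S) ->
  (forall e, e \in induced E S -> e \in cover F) ->
  isolated_or_cycle4 E S.
Proof.
move=> sE dE /subsetP Fc FS SF; apply/forall_inP => _ /imsetP[x xS ->].
set C := [set y in S | _].
have xC : x \in C by rewrite !inE xS connect0.
have SFe u v : [set u; v] \in induced E S ->
    exists2 Q, Q \in F & [set u; v] \in Q /\ (u \in cover Q /\ v \in cover Q).
  move=> /SF/bigcupP[Q QF uvQ]; exists Q => //; split=> //.
  by split; apply: (subsetP (block_sub_cover uvQ)); rewrite ?set21 ?set22.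
have [x0|] := boolP [forall y, [set x; y] \notin induced E S].
  apply/orP; left; apply/cards1P; exists x; apply/eqP.
  rewrite eqEsubset sub1set xC andbT; apply/subsetP => y.
  rewrite !inE => /andP[_ /connectP[[|z p] /= pxy ->] //].
  by case/andP: pxy; rewrite (negbTE (forallP x0 z)).
rewrite negb_forall => /existsP[y]; rewrite negbK => /SFe[Q QF [_ [xQ _]]].
apply/orP; right.
have [a [b [c [d [u eQ QE]]]]] := cycles4P _ _ (Fc _ QF).
have eC : C = cover Q.
  apply/eqP; rewrite eqEsubset; apply/andP; split; apply/subsetP => z.
    rewrite inE => /andP[_ /connectP[p pxz ->]].
    elim: p x xQ pxz {xS C xC y} => //= w p IHp v vQ /andP[vw]; apply: IHp.
    have [Q' Q'F [_ [vQ' wQ']]] := SFe _ _ vw.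
    by rewrite (disjoint_cycles4P dE (Fc _ QF) (Fc _ Q'F) vQ vQ').
  move=> zQ; rewrite inE (subsetP (FS _ QF) _ zQ) /=.
  have step v w : [set v; w] \in Q -> linked E S v w.
    move=> vwQ; apply: connect1; rewrite /= inE (subsetP QE _ vwQ) /=.
    exact: subset_trans (block_sub_cover vwQ) (FS _ QF).
  have sym v w : linked E S v w = linked E S w v.
    by apply: sym_connect_sym => s t /=; rewrite setUC.
  have toa v : v \in cover Q -> linked E S a v.
    rewrite {1}eQ cover_cycle4 !inE -!orbA => /or4P[] /eqP ->.
    - exact: connect0.
    - by apply: step; rewrite eQ !inE eqxx.
    - by apply: (@connect_trans _ _ b); apply: step; rewrite eQ !inE eqxx ?orbT.
    - by rewrite sym; apply: step; rewrite eQ !inE eqxx ?orbT.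
  by apply: (@connect_trans _ _ a); [rewrite -/(linked E S x a) sym|]; exact: toa.
apply/is_cycle4P; exists a, b, c, d; split=> //.
  by rewrite eC eQ cover_cycle4.
rewrite -eQ; apply/setP => e; rewrite inE; apply/andP/idP => [[eE eC']|eQe].
  have /SF/bigcupP[Q' Q'F eQ'] : e \in induced E S.
    by rewrite inE eE (subset_trans eC') // eC FS.
  have [z ze] := edge_incident sE eE.
  rewrite (@disjoint_cycles4P E z Q Q') ?Fc //.
    by rewrite -eC (subsetP eC').
  by apply/bigcupP; exists e.
by rewrite (subsetP QE) // eC; split=> //; exact: block_sub_cover.
Qed.

(** Start from the centres of the stars of an optimal decomposition and from its
    4-cycles, push the centres off the cycles, and let [S] be the complement of
    the set obtained. *)
Lemma tau_ge_gamma E : E \subset pairs V -> disjoint_cycles4 E ->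
  exists2 S, isolated_or_cycle4 E S & #|V| - gamma E S <= tau E.
Proof.
move=> sE dE; have [F /andP[pF /forall_inP bF] ->] := tau_attained sE.
have [/eqP coverF _ F0] := and3P pF.
have FE Q : Q \in F -> Q \subset E by rewrite -coverF; exact: block_sub_cover.
(* Only the choice of a default centre requires a vertex. *)
have [V0|[v0 _]] := set_0Vmem [set: V].
  exists set0; last by rewrite -cardsT V0 cards0.
  by apply/forall_inP => C; rewrite /components /equivalence_partition imset0 inE.
pose centre Q := odflt v0 [pick v in \bigcap_(e in Q) e].
pose T := centre @: (F :\: cycles4 E).
have centreP Q e : Q \in F -> Q \notin cycles4 E -> e \in Q -> centre Q \in e.
  move=> QF Qc eQ; rewrite /centre; case: pickP => [v /bigcapP/(_ _ eQ)//|].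
  have [|v vQ /(_ v)/negP[]] := biclique_star_or_cycle4 dE (FE _ QF) (bF _ QF) _ Qc.
    by apply: contraNneq F0 => <-.
  by apply/bigcapP.
have [||F' [T' [F'c leF touch dF]]] := @transversal_off_cycles E (F :&: cycles4 E) T.
- exact: subsetIr.
- move=> e; rewrite -{1}coverF => /bigcupP[Q QF eQ] eF; exists (centre Q).
    apply: imset_f; rewrite inE QF andbT; apply: contra eF => Qc.
    by apply/bigcupP; exists Q; rewrite // inE QF.
  apply: centreP => //; apply: contra eF => Qc.
  by apply/bigcupP; exists Q; rewrite // inE QF.
have SF e : e \in induced E (~: T') -> e \in cover F'.
  rewrite inE => /andP[eE eT']; apply: contraTT eT' => /touch-/(_ eE)[x xT' xe].
  by apply/subsetPn; exists x; rewrite // inE negbK.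
have FS Q : Q \in F' -> cover Q \subset ~: T'.
  by move=> /dF; rewrite disjoints_subset.
exists (~: T'); first exact: isolated_or_cycle4_of_cycles F'c _ _.
(* A 4-cycle inside the complement of [T'] shares an edge with a cycle kept in
   [F'], hence equals it. *)
have le_c : #|cycles4 (induced E (~: T'))| <= #|F'|.
  apply/subset_leq_card/subsetP => Q; rewrite inE powersetE => /andP[QS Qc].
  have QE : Q \in cycles4 E.
    by rewrite inE powersetE Qc andbT (subset_trans QS) // /induced setIdE subsetIl.
  have [a [b [c [d [_ eQ _]]]]] := cycles4P _ _ QE.
  have abQ : [set a; b] \in Q by rewrite eQ !inE eqxx.
  have /bigcupP[Q' Q'F abQ'] := SF _ (subsetP QS _ abQ).
  have aQ := subsetP (block_sub_cover abQ) _ (set21 a b).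
  have aQ' := subsetP (block_sub_cover abQ') _ (set21 a b).
  by rewrite (disjoint_cycles4P dE QE (subsetP F'c _ Q'F) aQ aQ').
have le_T : #|T| <= #|F :\: cycles4 E| by exact: leq_imset_card.
have := cardsID (cycles4 E) F; have := cardsC T'; rewrite /gamma; lia.
Qed.

Theorem tau_disjoint_cycles4 E : E \subset pairs V -> disjoint_cycles4 E ->
  tau E = #|V| - \max_(S : {set V} | isolated_or_cycle4 E S) gamma E S.
Proof.
move=> sE dE; have [S0 iso0 ge0] := tau_ge_gamma sE dE.
apply/eqP; rewrite eqn_leq; apply/andP; split.
  have [|S isoS ->] := @eq_bigmax_cond _ (isolated_or_cycle4 E) (gamma E).
    by apply/card_gt0P; exists S0.
  exact: tau_le_gamma.
exact: leq_trans (leq_sub2l _ (leq_bigmax_cond _ iso0)) ge0.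
Qed.

End Graphs.

(** * Meeting 4-cycles span many edges *)

Section Density.
Variable V : finType.

Definition cycle4_edges (a b c d : V) : seq {set V} :=
  [:: [set a; b]; [set b; c]; [set c; d]; [set d; a]].

Lemma uniq_cycle4_edges a b c d :
  uniq [:: a; b; c; d] -> uniq (cycle4_edges a b c d).
Proof.
have neq (x : V) (A B : {set V}) : x \in A -> x \notin B -> A != B.
  by move=> xA; apply: contraNneq => <-.
rewrite /= !inE !negb_or -!andbA => /and5P[ab ac ad bc /and3P[bd cd _]].
rewrite (@neq a) ?(@neq a [set a; b] [set c; d]) ?(@neq b [set a; b] [set d; a]) //=;
  rewrite ?(@neq b [set b; c]) ?(@neq c [set c; d]) ?inE ?eqxx ?orbT //=;
  by rewrite !negb_or ?ab ?ac ?ad ?bc ?bd ?cd // eq_sym ?ab ?ac.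
Qed.

Lemma mem_cycle4 a b c d (e : {set V}) :
  (e \in cycle4 a b c d) = (e \in cycle4_edges a b c d).
Proof. by rewrite !inE -!orbA. Qed.

Lemma card_cycle4D a b c d (Q : {set {set V}}) : uniq [:: a; b; c; d] ->
  #|cycle4 a b c d :\: Q| = count [pred e | e \notin Q] (cycle4_edges a b c d).
Proof.
move=> /uniq_cycle4_edges u; rewrite -size_filter.
rewrite -(card_uniqP (filter_uniq _ u)); apply: eq_card => e.
by rewrite in_setD mem_cycle4 mem_filter.
Qed.

Lemma card_cycle4 (a b c d : V) : uniq [:: a; b; c; d] -> #|cycle4 a b c d| = 4.
Proof.
move=> u; by rewrite -[cycle4 a b c d]setD0 card_cycle4D //= !inE.
Qed.

(** Each vertex of the second cycle outside [W] is on two of its edges, neither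
    of which is in the first cycle, and since [a'] lies in [W] the new vertices form paths, so
    k > 0 of them bring at least k + 1 new edges.  When k = 0 the second cycle,
    being different, still has an edge that the first one lacks. *)
Lemma card_meeting_cycles4 (a b c d a' b' c' d' : V) (W := [set a; b; c; d]) :
  uniq [:: a; b; c; d] -> uniq [:: a'; b'; c'; d'] -> a' \in W ->
  cycle4 a b c d != cycle4 a' b' c' d' ->
  5 + (b' \notin W) + (c' \notin W) + (d' \notin W)
    <= #|cycle4 a b c d :|: cycle4 a' b' c' d'|.
Proof.
set Q := cycle4 a b c d; set Q' := cycle4 _ _ _ _ => u u' a'W neq.
have -> : #|Q :|: Q'| = 4 + #|Q' :\: Q|.
  by rewrite -(card_cycle4 u) -cardsUI setDE setUIr setUCr setIT setICA setICr setI0 cards0 addn0.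
have new x (e : {set V}) : x \in e -> x \notin W -> e \notin Q.
  move=> xe; apply: contra => eQ; rewrite /W -cover_cycle4.
  exact: subsetP (block_sub_cover eQ) x xe.
have ge1 : 0 < #|Q' :\: Q|.
  rewrite card_gt0 setD_eq0; apply: contra neq => Q'Q.
  by rewrite eq_sym eqEcard Q'Q !card_cycle4.
have := ge1; rewrite card_cycle4D //=.
have nb : b' \notin W -> ([set a'; b'] \notin Q) && ([set b'; c'] \notin Q).
  by move=> b'W; rewrite !(new _ _ _ b'W) ?set21 ?set22.
have nc : c' \notin W -> ([set b'; c'] \notin Q) && ([set c'; d'] \notin Q).
  by move=> c'W; rewrite !(new _ _ _ c'W) ?set21 ?set22.
have nd : d' \notin W -> ([set c'; d'] \notin Q) && ([set d'; a'] \notin Q).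
  by move=> d'W; rewrite !(new _ _ _ d'W) ?set21 ?set22.
rewrite !addn0; move: nb nc nd.
case: (b' \notin W); case: (c' \notin W); case: (d' \notin W);
by do 4 case: (_ \notin Q) => //=; do ?[case/(_ isT)/andP=> //| move=> //].
Qed.

(** Cycles are rotated so that the shared vertex comes first in the second one;
    this is what makes the sum over the second cycle a product below. *)
Lemma not_disjoint_cycles4 (E : {set {set V}}) : ~~ disjoint_cycles4 E ->
  exists a b c d a' b' c' d' : V,
  [/\ uniq [:: a; b; c; d], uniq [:: a'; b'; c'; d'], a' \in [set a; b; c; d],
      cycle4 a b c d != cycle4 a' b' c' d' &
      cycle4 a b c d :|: cycle4 a' b' c' d' \subset E].
Proof.
rewrite negb_forall_in => /exists_inP[Q].
case/cycles4P=> a [b [c [d [u -> QE]]]].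
rewrite negb_forall_in => /exists_inP[Q'].
case/cycles4P=> a' [b' [c' [d' [u' -> Q'E]]]].
rewrite negb_imply => /andP[neq]; rewrite !cover_cycle4 -setI_eq0.
case/set0Pn => x /setIP[xW xW'].
exists a, b, c, d.
wlog ea : a' b' c' d' u' Q'E neq xW' / x = a'.
  move=> IH; have rot s t v w : uniq [:: s; t; v; w] -> uniq [:: t; v; w; s].
    by rewrite -(rot_uniq 1).
  have := xW'; rewrite !inE -!orbA => /or4P[] /eqP ex.
  - exact: IH u' _ _ _ ex.
  - apply: (IH b' c' d' a'); rewrite ?(cycle4_rot a' b' c' d') //; first exact: rot.
    by rewrite ex !inE eqxx.
  - apply: (IH c' d' a' b');
    rewrite ?(cycle4_rot b' c' d' a') ?(cycle4_rot a' b' c' d') //; first exact/rot/rot.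
    by rewrite ex !inE eqxx.
  - apply: (IH d' a' b' c'); rewrite ?(cycle4_rot c' d' a' b')
    ?(cycle4_rot b' c' d' a') ?(cycle4_rot a' b' c' d') //; first exact/rot/rot/rot.
    by rewrite ex !inE eqxx.
by exists a', b', c', d'; split=> //; [rewrite -ea | rewrite subUset QE].
Qed.

End Density.

(** * Union bounds in the random graph *)

Local Open Scope ring_scope.

Section Probability.
Variables (R : realFieldType) (V : finType) (p : R).
Hypothesis p01 : 0 <= p <= 1.
Implicit Types (E : {set {set V}}) (P : pred {set {set V}}).

Lemma gnp_weight_ge0 E : 0 <= gnp_weight p E.
Proof.
by have /andP[p0 p1] := p01; apply: prodr_ge0 => e _; case: ifP; rewrite ?subr_ge0.
Qed.

Lemma gnp_prob_ge0 P : 0 <= gnp_prob p P.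
Proof. by apply: sumr_ge0 => E _; exact: gnp_weight_ge0. Qed.

Lemma gnp_probC P : gnp_prob p P + gnp_prob p (fun E => ~~ P E) = 1.
Proof.
rewrite -(gnp_prob_total V p) /gnp_prob [RHS](bigID P) /=.
by congr (_ + _); apply: eq_bigl => E; rewrite andbT.
Qed.

Lemma gnp_union_bound (I : finType) (A : pred I) (X : I -> pred {set {set V}}) P :
  (forall E, E \subset pairs V -> P E -> exists2 i, A i & X i E) ->
  gnp_prob p P <= \sum_(i | A i) gnp_prob p (X i).
Proof.
move=> PX; rewrite /gnp_prob.
rewrite (exchange_big_dep (fun E => E \in powerset (pairs V))) /=; last first.
  by move=> i E _ /andP[].
rewrite big_mkcondr /=; apply: ler_sum => E; rewrite powersetE => sE.
have ge0 (B : pred I) : 0 <= \sum_(i | B i) gnp_weight p E.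
  by apply: sumr_ge0 => i _; exact: gnp_weight_ge0.
case: ifP => // /(PX _ sE)[i Ai XiE].
by rewrite (bigD1 i) ?Ai ?powersetE ?sE //= ler_wpDr.
Qed.

Lemma gnp_prob_mono P P' :
  (forall E, E \subset pairs V -> P E -> P' E) -> gnp_prob p P <= gnp_prob p P'.
Proof.
move=> PP'; apply: le_trans (_ : \sum_(i : unit) gnp_prob p P' <= _).
  by apply: (@gnp_union_bound _ _ (fun=> P')) => E sE /(PP' E sE); exists tt.
by rewrite big_const card_unit /= addr0.
Qed.

(** One free vertex of the second cycle: it is one of the at most k vertices
    of the first cycle, at no cost, or any vertex at the cost of one more
    edge. *)
Lemma sum_powers_outside (W : {set V}) (k : nat) : (#|W| <= k)%N ->
  \sum_x p ^+ (x \notin W) <= k%:R + #|V|%:R * p.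
Proof.
move=> Wk; have /andP[p0 p1] := p01; rewrite (bigID [in W]) /=.
rewrite (eq_bigr (fun=> 1)); last by move=> x ->.
rewrite [X in _ + X](eq_bigr (fun=> p)); last by move=> x ->.
rewrite !sumr_const -[p *+ _]mulr_natl; apply: lerD; first by rewrite ler_nat.
by apply: ler_wpM2r; rewrite // ler_nat max_card.
Qed.

(** The factors come from choosing, in this order, the first cycle, the shared
    vertex, and the three other vertices of the second cycle. *)
Lemma prob_meeting_cycles4_le :
  gnp_prob p (fun E => ~~ disjoint_cycles4 E)
    <= #|V|%:R ^+ 4 * (4%:R * p ^+ 5 * (4%:R + #|V|%:R * p) ^+ 3).
Proof.
have /andP[p0 p1] := p01.
pose cyc (q : V * V * V * V) := cycle4 q.1.1.1 q.1.1.2 q.1.2 q.2.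
pose W (q : V * V * V * V) := [set q.1.1.1; q.1.1.2; q.1.2; q.2].
pose A (i : (V * V * V * V) * (V * V * V * V)) :=
  [&& uniq [:: i.1.1.1.1; i.1.1.1.2; i.1.1.2; i.1.2],
      uniq [:: i.2.1.1.1; i.2.1.1.2; i.2.1.2; i.2.2],
      i.2.1.1.1 \in W i.1 & cyc i.1 != cyc i.2].
pose f q x := p ^+ (x \notin W q).
apply: le_trans (_ : \sum_(i | A i) gnp_prob p (fun E => cyc i.1 :|: cyc i.2 \subset E) <= _).
  apply: gnp_union_bound => E _ /not_disjoint_cycles4.
  case=> a [b [c [d [a' [b' [c' [d' [? ? ? ? ?]]]]]]]].
  by exists (a, b, c, d, (a', b', c', d')) => //; apply/and4P; split.
apply: (@le_trans _ _ (\sum_(i | i.2.1.1.1 \in W i.1)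
  p ^+ 5 * f i.1 i.2.1.1.2 * f i.1 i.2.1.2 * f i.1 i.2.2)).
  rewrite big_mkcond [leRHS]big_mkcond /=; apply: ler_sum => -[q q'] _ /=.
  have f0 x : 0 <= f q x by exact: exprn_ge0.
  case: ifP => [/and4P[/= u u' a'W neq]|_]; last first.
    by case: ifP => // _; rewrite !mulr_ge0 ?exprn_ge0.
  rewrite a'W gnp_prob_edges; last by rewrite subUset !cycle4_pairs.
  rewrite -!exprD ler_wiXn2l //.
  exact: card_meeting_cycles4.
rewrite -(pair_big_dep xpredT (fun q q' => q'.1.1.1 \in W q)
  (fun q q' => p ^+ 5 * f q q'.1.1.2 * f q q'.1.2 * f q q'.2)) /=.
have card4 : #|{: V * V * V * V}| = (#|V| ^ 4)%N by rewrite !card_prod; lia.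
rewrite -natrX -card4 mulr_natl -sumr_const; apply: ler_sum => q _.
have W4 : (#|W q| <= 4)%N.
  rewrite (eq_card (B := mem [:: q.1.1.1; q.1.1.2; q.1.2; q.2])) ?card_size //.
  by move=> x; rewrite !inE -!orbA.
set S := \sum_x f q x.
have -> : \sum_(q' | q'.1.1.1 \in W q)
    p ^+ 5 * f q q'.1.1.2 * f q q'.1.2 * f q q'.2 = #|W q|%:R * p ^+ 5 * S ^+ 3.
  transitivity (#|W q|%:R * p ^+ 5 * S * S * S); last by ring.
  transitivity (\sum_(t | t.1.1 \in W q) p ^+ 5 * f q t.1.2 * f q t.2 * S).
    under [RHS]eq_bigr do rewrite mulr_sumr.
    by rewrite pair_big_dep; apply: eq_bigl => -[t x] /=; rewrite andbT.
  rewrite -mulr_suml.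
  transitivity (\sum_(t | t.1 \in W q) p ^+ 5 * f q t.2 * S * S).
    rewrite -mulr_suml; congr (_ * S).
    under [RHS]eq_bigr do rewrite mulr_sumr.
    by rewrite pair_big_dep; apply: eq_bigl => -[t x] /=; rewrite andbT.
  rewrite -!mulr_suml; congr (_ * S * S).
  transitivity (\sum_(t in W q) p ^+ 5 * S).
    under [RHS]eq_bigr do rewrite mulr_sumr.
    by rewrite pair_big_dep; apply: eq_bigl => -[t x] /=; rewrite andbT.
  by rewrite sumr_const -mulrA mulr_natl.
apply: ler_pM.
- by rewrite mulr_ge0 ?exprn_ge0.
- by rewrite exprn_ge0 // sumr_ge0 // => x _; rewrite exprn_ge0.
- by rewrite ler_wpM2r ?exprn_ge0 // ler_nat.
by rewrite lerXn2r ?nnegrE ?sum_powers_outside // ?sumr_ge0 // => *;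
  rewrite ?exprn_ge0 // addr_ge0 ?mulr_ge0.
Qed.

End Probability.

(** * The limit *)

(** The union bound at edge probability [x], where [y ^+ 8] stands for the number
    of vertices, so that no real powers occur: it is at most
    [y^32 * 4 d^5 y^(-35) * (5 y)^3 = 4 * 5^3 * d^5]. *)
Lemma meeting_cycles4_bound (R : realFieldType) :
  exists2 K : R, 0 < K & forall x y d : R,
    1 <= y -> 0 <= d <= 1 -> 0 <= x <= d * y ^- 7 ->
    (y ^+ 8) ^+ 4 * (4%:R * x ^+ 5 * (4%:R + y ^+ 8 * x) ^+ 3) <= K * d.
Proof.
have K0 : 0 < 4%:R * 5%:R ^+ 3 :> R by rewrite mulr_gt0 ?exprn_gt0 ?ltr0n.
exists (4%:R * 5%:R ^+ 3) => // x y d.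
move=> y1 /andP[d0 d1] /andP[x0 xd]; have y0 : 0 < y by exact: lt_le_trans y1.
have yx : y ^+ 8 * x <= y.
  rewrite (le_trans (ler_wpM2l (exprn_ge0 8 (ltW y0)) xd)) //.
  have -> : y ^+ 8 * (d * y ^- 7) = d * y by field; rewrite gt_eqF.
  by rewrite ler_piMl // ltW.
have x5 : x ^+ 5 <= (d * y ^- 7) ^+ 5 by rewrite lerXn2r ?nnegrE ?mulr_ge0 ?invr_ge0 ?exprn_ge0 // ltW.
have s3 : (4%:R + y ^+ 8 * x) ^+ 3 <= (5%:R * y) ^+ 3.
  rewrite lerXn2r ?nnegrE ?addr_ge0 ?mulr_ge0 ?exprn_ge0 ?(ltW y0) //.
  by move: yx y1; lra.
apply: (@le_trans _ _ ((y ^+ 8) ^+ 4 * (4%:R * (d * y ^- 7) ^+ 5 * (5%:R * y) ^+ 3))).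
  rewrite ler_wpM2l ?exprn_ge0 ?(ltW y0) // ler_pM ?exprn_ge0 ?mulr_ge0 ?exprn_ge0 //.
    by rewrite addr_ge0 ?mulr_ge0 ?exprn_ge0 ?(ltW y0).
  by rewrite ler_wpM2l.
have -> : (y ^+ 8) ^+ 4 * (4%:R * (d * y ^- 7) ^+ 5 * (5%:R * y) ^+ 3)
    = 4%:R * 5%:R ^+ 3 * d ^+ 5.
  by field; rewrite gt_eqF.
rewrite (ler_pM2l K0) exprS ler_piMr //; exact: exprn_ile1.
Qed.

Lemma dist_tau_eq_prob_le (R : realFieldType) (V : finType) (p : R) : 0 <= p <= 1 ->
  `|1 - gnp_prob p (fun E : {set {set V}} =>
      tau E == (#|V| - \max_(S : {set V} | isolated_or_cycle4 E S) gamma E S)%N)|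
    <= #|V|%:R ^+ 4 * (4%:R * p ^+ 5 * (4%:R + #|V|%:R * p) ^+ 3).
Proof.
move=> p01; set G := fun E => _.
have -> : 1 - gnp_prob p G = gnp_prob p (fun E => ~~ G E).
  by rewrite -(gnp_probC p G) addrAC subrr add0r.
rewrite ger0_norm ?gnp_prob_ge0 //.
apply: le_trans (prob_meeting_cycles4_le _ p01).
apply: gnp_prob_mono => // E sE; apply: contra => dE.
by rewrite /G tau_disjoint_cycles4.
Qed.

Local Open Scope classical_set_scope.

Theorem proposition1p3 (R : realType) (p : nat -> R)
    (p01 : forall n : nat, 0 <= p n <= 1)
    (p_small : (p : nat -> R^o) =o_\oo
       (fun n : nat => n%:R `^ (- (7%:R / 8%:R)) : R^o)) :
  gnp_prob (p n) (fun E : {set {set 'I_n}} =>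
      tau E == (n - \max_(S : {set 'I_n} | isolated_or_cycle4 E S) gamma E S)%N)
    @[n --> \oo] --> (1 : R).
Proof.
have [K K0 bound] := meeting_cycles4_bound R.
apply/cvgrPdist_le => e e0.
have d0 : 0 < Num.min 1 (e / K) by rewrite lt_min ltr01 divr_gt0.
have := p_small; move/eqoP => /(_ _ d0) p_le.
near=> n.
have n1 : (0 < n)%N by near: n; exact: nbhs_infty_gt.
have := @dist_tau_eq_prob_le R 'I_n (p n) (p01 n); rewrite card_ord => /le_trans; apply.
pose y := n%:R `^ 8%:R^-1 : R.
have ny : n%:R = y ^+ 8.
  by rewrite -powR_mulrn ?powR_ge0 // -powRrM mulVf // powRr1.
apply: (@le_trans _ _ (K * Num.min 1 (e / K))); last first.
  by rewrite mulrC -ler_pdivlMr // ge_min lexx orbT.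
rewrite ny; apply: bound.
- by rewrite -(powRr0 n%:R) ler_powR ?invr_ge0 // ler1n.
- by rewrite ltW //= ge_min lexx.
have /andP[-> _] := p01 n => /=.
have : `|p n| <= Num.min 1 (e / K) * `|(n%:R `^ (- (7%:R / 8%:R)) : R)|.
  by near: n; exact: p_le.
rewrite ger0_norm ?ger0_norm ?powR_ge0 //; last by case/andP: (p01 n).
move=> /le_trans; apply; rewrite ler_wpM2l ?(ltW d0) //.
rewrite -exprVn /y -powRN -powR_mulrn ?powR_ge0 // -powRrM.
by rewrite mulNr mulrC.
Unshelve. all: by end_near.
Qed.
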